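(* Let $q=p^k$ with $p$ prime. Let $f_1, f_2,\ldots,f_m:\mathbb{F}_{q^n} \rightarrow \mathbb{F}_q$ be mappings, and let $h_1, h_2, \ldots,h_m$ be permutations of $\mathbb{F}_q$. Let $L:\mathbb{F}_{q^n}\rightarrow \mathbb{F}_{q^n}$ be an $\mathbb{F}_q$-linear polynomial with $\operatorname{Ker} L\cap \operatorname{Im} L=\{0\}$, and let $A(x)=x^{p^t}: \mathbb{F}_q\rightarrow \mathbb{F}_q$, where $t$ is a nonnegative integer with $t\leq k$. Let $\gamma_1,\gamma_2,\ldots,\gamma_m$ be a basis of $\operatorname{Ker} L$ over $\mathbb{F}_q$, and let $b_{ij}\in\mathbb{F}_q$ for $1\leq i,j\leq m$. If $\gamma_i$ is a $(b_{ij}, A)$-linear translator of $f_j$ for all $1\leq i,j \leq m$, then $$F(x)=L(x)+\sum_{i=1}^{m}\gamma_i\bigl(h_i(f_i(x))\bigr)^{p^t}$$ permutes $\mathbb{F}_{q^n}$ if and only if $\operatorname{rank}(B)=m$, where $B$ is the $m\times m$ matrix over $\mathbb{F}_q$ given by $B=\bigl(b_{ij}^{p^{k-t}}\bigr)_{1\le i,j\le m}$.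
   Context: $n,m,k$ are positive integers. Let $f:\mathbb{F}_{q^n}\to\mathbb{F}_q$ be a function, $A$ an additive permutation polynomial over $\mathbb{F}_q$ (a polynomial $A(x)\in\mathbb{F}_q[x]$ with $A(x+y)=A(x)+A(y)$ inducing a permutation of $\mathbb{F}_q$; $x^{p^t}$ is one), and $b\in\mathbb{F}_q$ fixed. A nonzero element $\gamma\in\mathbb{F}_{q^n}$ is called a $(b,A)$-linear translator of $f$ if $f(x+u\gamma)-f(x)=bA(u)$ for all $x\in\mathbb{F}_{q^n}$ and all $u\in\mathbb{F}_q$. An $\mathbb{F}_q$-linear polynomial is one inducing an $\mathbb{F}_q$-linear map on $\mathbb{F}_{q^n}$; $\operatorname{Ker} L$ and $\operatorname{Im} L$ are the kernel and image of this map. *)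

(* Defs.v *)
From HB Require Import structures.
From mathcomp Require Import all_boot all_order all_algebra all_fingroup all_field.

Set Implicit Arguments.
Unset Strict Implicit.
Unset Printing Implicit Defensive.

Import GRing.Theory.
Local Open Scope ring_scope.

(* A finite extension E of a finite field F with \dim {:E} = n is F_{q^n},
   F being F_q; the image of u in F inside E is u%:A, so that u * gamma
   is u *: gamma. *)
Section LinearTranslators.

Variables (F : finFieldType) (E : fieldExtType F).

Definition linear_poly (P : {poly E}) : Prop :=
  linear (fun x : E => P.[x] : E).

(* poly_end P is the F-linear map induced by P only when linear_poly P. *)
Definition poly_end (P : {poly E}) : 'End(E) := linfun (horner P).

(* A ranges over additive permutation polynomials of F, e.g. 'X^(p ^ t) with
   p the characteristic of F. *)
Definition linear_translator (f : E -> F) (b : F) (A : {poly F}) (gamma : E)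
  : Prop :=
  gamma != 0 /\ forall (x : E) (u : F), f (x + u *: gamma) - f x = b * A.[u].

End LinearTranslators.

(* Main.v *)
Require Import Defs.
From HB Require Import structures.
From mathcomp Require Import all_boot all_order all_algebra all_fingroup all_field.

(** The fibres of
      G x = L x + \sum_i (h_i (f_i x))^(p^t) gamma_i
    can be read off explicitly.  The first summand lies in Im L and the second
    one in Ker L; as these meet trivially, the gamma_i are independent and both
    h_i and z |-> z^(p^t) are injective, G x = G y amounts to
      L x = L y  and  f_j x = f_j y  for all j
    ([combine_fibre]).

    The first condition says that x - y lies in Ker L, i.e. that
    x = y + \sum_i u_i gamma_i for some row vector u.  Adding the gamma_i one at
    a time, the translator property gives
      f_j x - f_j y = \sum_i b_ij u_i^(p^t),
    and since z |-> z^(p^(k-t)) inverts z |-> z^(p^t) on F, the right-hand side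
    is the p^t-th power of the j-th entry of u *m B ([translate_by_kernel]).

    So the points identified by G are exactly those that differ by
    \sum_i u_i gamma_i with u *m B = 0, and G is injective if and only if the
    rows of B are independent.  Finally, E is a finite set, so that injectivity
    and bijectivity of G coincide. *)

Set Implicit Arguments.
Unset Strict Implicit.
Unset Printing Implicit Defensive.

Import GRing.Theory.
Local Open Scope ring_scope.

Section FrobeniusPowers.

Variables (F : finFieldType) (p k t : nat).
Hypotheses (p_prime : prime p) (t_le_k : (t <= k)%N) (cardF : #|F| = (p ^ k)%N).

(** Raising to the power p^k = #|F| is the identity of F. *)
Lemma frobenius_powK :
  cancel (fun z : F => z ^+ (p ^ t)) (fun z => z ^+ (p ^ (k - t))).
Proof. by move=> z; rewrite -exprM -expnD subnKC // -cardF expf_card. Qed.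

Lemma frobenius_powVK :
  cancel (fun z : F => z ^+ (p ^ (k - t))) (fun z => z ^+ (p ^ t)).
Proof. by move=> z; rewrite -exprM -expnD subnK // -cardF expf_card. Qed.

Lemma frobenius_pow_sum I (r : seq I) (P : pred I) (z : I -> F) :
  (\sum_(i <- r | P i) z i) ^+ (p ^ t) = \sum_(i <- r | P i) z i ^+ (p ^ t).
Proof.
have pcharF : p \in [pchar F] by apply: card_finPcharP cardF p_prime.
apply: (big_morph (fun z : F => z ^+ (p ^ t))) => [y w|].
  by rewrite exprDn_pchar // pnatX orbC pnatE // pcharF orbT.
by rewrite expr0n expn_eq0 eqn0Ngt prime_gt0.
Qed.

End FrobeniusPowers.

Section Fibres.

Variables (F : finFieldType) (E : fieldExtType F).

(** The translator property holds at every point, so the translations can be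
    performed one after the other, each at the point reached so far. *)
Lemma translator_sum I (r : seq I) (f : E -> F) (b : I -> F) (A : {poly F})
    (gamma : I -> E) (u : I -> F) (x : E) :
  (forall i, linear_translator f (b i) A (gamma i)) ->
  f (x + \sum_(i <- r) u i *: gamma i) = f x + \sum_(i <- r) b i * A.[u i].
Proof.
move=> trf; elim: r x => [|i r IHr] x; first by rewrite !big_nil !addr0.
rewrite !big_cons addrA IHr addrA; congr (_ + _).
by have [_ /(_ x (u i)) <-] := trf i; rewrite [RHS]addrC subrK.
Qed.

(** The exponent p^(k-t) in the matrix turns b_ij into a p^t-th power, so that
    the whole increment of f j becomes the p^t-th power of a linear form. *)
Lemma translate_by_kernel m p k t (f : 'I_m -> E -> F) (b : 'M[F]_m)
    (gamma : 'I_m -> E) (x : E) (u : 'rV[F]_m) (j : 'I_m) :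
    prime p -> (t <= k)%N -> #|F| = (p ^ k)%N ->
    (forall i j, linear_translator (f j) (b i j) 'X^(p ^ t) (gamma i)) ->
  f j (x + \sum_i u 0 i *: gamma i) =
    f j x + ((u *m \matrix_(i, j) b i j ^+ (p ^ (k - t))) 0 j) ^+ (p ^ t).
Proof.
move=> p_prime t_le_k cardF trf.
rewrite (translator_sum _ _ _ (fun i => trf i j)) mxE.
rewrite (frobenius_pow_sum _ p_prime cardF); congr (_ + _).
apply: eq_bigr => i _.
by rewrite hornerXn mxE exprMn frobenius_powVK // mulrC.
Qed.

(** The equation equates l (x - y), in Im l, with a combination of the gamma_i,
    in Ker l.  Both sides therefore vanish, and freeness of gamma separates the
    coefficients. *)
Lemma combine_fibre m (l : 'End(E)) (gamma : m.-tuple E) (c d : 'I_m -> F)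
    (x y : E) :
    (lker l :&: limg l)%VS = 0%VS -> basis_of (lker l) gamma ->
    l x + \sum_i c i *: tnth gamma i = l y + \sum_i d i *: tnth gamma i ->
  l x = l y /\ c =1 d.
Proof.
move=> disj basis_g eq_xy.
have eq_diff : l (x - y) = \sum_i (d i - c i) *: gamma`_i.
  rewrite linearB /= -[l x](addrK (\sum_i c i *: tnth gamma i)) eq_xy.
  rewrite addrAC [l y + _]addrC addrK -sumrB.
  by apply: eq_bigr => i _; rewrite scalerBl (tnth_nth 0).
have diff0 : l (x - y) = 0.
  apply/eqP; rewrite -memv0 -disj memv_cap memv_img ?memvf // andbT eq_diff.
  apply: memv_suml => i _.
  by rewrite memvZ // (basis_mem basis_g) ?mem_nth ?size_tuple.
split; first by move: diff0; rewrite linearB => /subr0_eq.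
move: eq_diff; rewrite diff0 => /esym sum0 i.
have /freeP/(_ _ sum0 i) /eqP := basis_free basis_g.
by rewrite subr_eq0 => /eqP.
Qed.

(** [finvect_type E] is E with the finite type structure it gets from F. *)
Lemma ext_inj_bij (g : E -> E) : injective g -> bijective g.
Proof. by move=> g_inj; apply: (@injF_bij (finvect_type E)). Qed.

End Fibres.

Theorem theorem3p9
  (n m k p t : nat) (n_gt0 : (0 < n)%N) (m_gt0 : (0 < m)%N) (k_gt0 : (0 < k)%N)
  (p_prime : prime p) (t_le_k : (t <= k)%N)
  (F : finFieldType) (cardF : #|F| = (p ^ k)%N)
  (E : fieldExtType F) (dimE : \dim {:E} = n)
  (f : 'I_m -> E -> F) (h : 'I_m -> {perm F})
  (L : {poly E}) (L_linear : linear_poly L)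
  (L_disjoint : (lker (poly_end L) :&: limg (poly_end L))%VS = 0%VS)
  (gamma : m.-tuple E) (gamma_basis : basis_of (lker (poly_end L)) gamma)
  (b : 'M[F]_m)
  (translators : forall i j : 'I_m,
     linear_translator (f j) (b i j) 'X^(p ^ t) (tnth gamma i)) :
  bijective (fun x : E =>
    L.[x] + \sum_(i < m) (h i (f i x)) ^+ (p ^ t) *: tnth gamma i)
  <-> \rank (\matrix_(i < m, j < m) (b i j) ^+ (p ^ (k - t))) = m.
Proof.
set G := (fun x : E => _); set B := (\matrix_(i, j) _).
pose l := poly_end L.
(* linfun agrees with a function only through its linear structure, which
   L_linear supplies for evaluation of L. *)
pose lL := GRing.isLinear.Build _ _ _ _ (horner L : E -> E) L_linear.
pose hL : {linear E -> E} := HB.pack (horner L : E -> E) lL.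
have lE x : L.[x] = l x by rewrite /l /poly_end -[horner L]/(hL : E -> E) lfunE.
have f_shift x (u : 'rV_m) j :
    f j (x + \sum_i u 0 i *: tnth gamma i) = f j x + (u *m B) 0 j ^+ (p ^ t).
  exact: translate_by_kernel.
split=> [/bij_inj G_inj | rankB].
  (* If u *m B = 0, then translating 0 by \sum_i u_i gamma_i changes neither L
     nor any f_j, so that injectivity of G makes this combination trivial. *)
  apply/eqP/inj_row_free => u uB0.
  have ker_sum : \sum_i u 0 i *: tnth gamma i \in lker l.
    by apply: memv_suml => i _; rewrite memvZ // (basis_mem gamma_basis) ?mem_tnth.
  have sum0 : \sum_i u 0 i *: tnth gamma i = 0.
    apply: G_inj; rewrite -[X in G X]add0r /G !lE linearD /=.
    move: ker_sum; rewrite memv_ker => /eqP ->; rewrite addr0; congr (_ + _).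
    apply: eq_bigr => i _.
    by rewrite f_shift uB0 mxE expr0n expn_eq0 eqn0Ngt prime_gt0 ?addr0.
  have /freeP gamma_indep := basis_free gamma_basis.
  apply/rowP => i; rewrite mxE; apply: (gamma_indep (u 0)); rewrite -[RHS]sum0.
  by apply: eq_bigr => j _; rewrite (tnth_nth 0).
apply: ext_inj_bij => x y; rewrite /G !lE.
case/(combine_fibre L_disjoint gamma_basis) => lxy pow_eq.
have f_eq j : f j x = f j y.
  apply: (perm_inj (s := h j)).
  exact: (can_inj (frobenius_powK t_le_k cardF)) (pow_eq j).
have ker_xy : x - y \in lker l by rewrite memv_ker linearB /= lxy subrr.
(* The coordinates of x - y are annihilated by B, as no f_j separates x from y. *)
pose u : 'rV[F]_m := \row_i coord gamma i (x - y).
have xE : x = y + \sum_i u 0 i *: tnth gamma i.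
  rewrite -[LHS](subrKC y) [in LHS](coord_basis gamma_basis ker_xy).
  by congr (_ + _); apply: eq_bigr => i _; rewrite mxE (tnth_nth 0).
suff u0 : u = 0.
  by rewrite xE big1 ?addr0 // => i _; rewrite u0 mxE scale0r.
have B_free : row_free B by apply/eqP.
apply: (row_free_inj B_free); rewrite mul0mx; apply/rowP => j.
have /eqP := f_eq j; rewrite xE f_shift -subr_eq0 addrAC subrr add0r.
by rewrite expf_eq0 => /andP[_ /eqP ->]; rewrite mxE.
Qed.
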